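(* For integers $k>1$ and $m\ge1$, the spider $G_\lambda$ on $mk+1$ nodes with partition $\lambda=(m,m,\ldots,m)$ of $mk$ into $k$ parts satisfies $$M(G_\lambda)=F_{m+1}^k-kF_{m-1}F_m^{k-1}.$$
   Context: A DAG with skeleton $G$ (a finite simple undirected graph) is an acyclic orientation of all edges of $G$. An immorality in a DAG is an induced subgraph $i\to j\leftarrow k$ (so $i,k$ are nonadjacent). Two DAGs are Markov equivalent iff they have the same skeleton and the same set of immoralities; a Markov equivalence class (MEC) with skeleton $G$ is an equivalence class of DAGs with skeleton $G$. $M(G)$ denotes the total number of MECs with skeleton $G$. For a partition $\lambda=(\lambda_1,\ldots,\lambda_k)$ into $k$ positive parts, $G_\lambda$ is the tree consisting of a center vertex joined to one endpoint of each of $k$ disjoint paths (legs) with $\lambda_1,\ldots,\lambda_k$ vertices (for $k=2$ this is just a path). Fibonacci numbers: $F_0=F_1=1$, $F_p=F_{p-1}+F_{p-2}$ for $p\ge2$. *)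

(* Defs.v *)
From mathcomp Require Import all_boot all_order all_algebra.

Set Implicit Arguments.
Unset Strict Implicit.
Unset Printing Implicit Defensive.

Record sgraph := SGraph {
  vertex :> finType;
  adj : rel vertex;
  adj_sym : symmetric adj;
  adj_irrefl : irreflexive adj
}.

Section Digraph.
Variable V : finType.

(* A digraph on V is its set of arcs; (x, y) stands for x -> y. *)
Implicit Type D : {set V * V}.

Definition arc D : rel V := fun x y => (x, y) \in D.

Definition skeleton D : rel V := fun x y => arc D x y || arc D y x.

Definition acyclic D : bool :=
  [forall x, forall y, arc D x y ==> ~~ connect (arc D) y x].

Lemma acyclicP D :
  reflect (forall c : seq V, cycle (arc D) c -> c = [::]) (acyclic D).
Proof.
apply: (iffP idP) => [ac [//|x c] /=|ac].
  case: c => [|y c] /=.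
    by rewrite andbT => xx; move/forallP/(_ x)/forallP/(_ x): ac; rewrite xx connect0.
  case/andP=> xy pc; move/forallP/(_ x)/forallP/(_ y): ac; rewrite xy /=.
  by case/negP; apply/connectP; exists (rcons c x); rewrite ?last_rcons.
apply/forallP=> x; apply/forallP=> y; apply/implyP=> xy.
apply/negP=> /connectP[p pp xl]; have /ac : cycle (arc D) (y :: p); last by [].
by rewrite /= rcons_path pp -xl.
Qed.

Definition immorality D (i j k : V) : bool :=
  [&& i != k, arc D i j, arc D k j & ~~ skeleton D i k].

Definition markov_equiv : rel {set V * V} := fun D1 D2 =>
  [forall x, forall y, skeleton D1 x y == skeleton D2 x y] &&
  [forall i, forall j, forall k, immorality D1 i j k == immorality D2 i j k].

Lemma markov_equivP D1 D2 :
  reflect (skeleton D1 =2 skeleton D2 /\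
           forall i j k, immorality D1 i j k = immorality D2 i j k)
          (markov_equiv D1 D2).
Proof.
apply: (iffP andP) => -[sk im]; split.
- by move=> x y; move/forallP/(_ x)/forallP/(_ y)/eqP: sk.
- by move=> i j k; move/forallP/(_ i)/forallP/(_ j)/forallP/(_ k)/eqP: im.
- by apply/forallP=> x; apply/forallP=> y; rewrite sk.
- by do 3![apply/forallP=> ?]; rewrite im.
Qed.

Lemma markov_equiv_equivalence : equivalence_rel markov_equiv.
Proof.
move=> D1 D2 D3; split; first by apply/markov_equivP.
case/markov_equivP=> sk im.
apply/markov_equivP/markov_equivP=> -[sk' im']; split=> [x y|i j k].
- by rewrite -sk.
- by rewrite -im.
- by rewrite sk.
- by rewrite im.
Qed.

End Digraph.

Section MEC.
Variable G : sgraph.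

Definition orientation (D : {set G * G}) : bool :=
  [forall x, forall y, (skeleton D x y == adj x y) &&
                       ~~ (arc D x y && arc D y x)].

Definition dags : {set {set G * G}} := [set D | orientation D && acyclic D].

Definition MECs : {set {set {set G * G}}} :=
  equivalence_partition (@markov_equiv G) dags.

Definition M : nat := #|MECs|.

End MEC.

Section Spider.
Variables (k : nat) (lambda : 'I_k -> nat).

(* A partition is given by its parts; spider makes sense without them being
   positive or sorted.  None is the center; Some (Tagged _ a) with tag i is the
   vertex of leg i at distance a.+1 from the center. *)
Definition spider_vertex : finType := option {i : 'I_k & 'I_(lambda i)}.

Definition spider_adj : rel spider_vertex := fun u v =>
  match u, v with
  | None, None => false
  | None, Some y => tagged y == 0 :> nat
  | Some x, None => tagged x == 0 :> nat
  | Some x, Some y =>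
      (tag x == tag y) && (((tagged x).+1 == tagged y :> nat) ||
                           ((tagged y).+1 == tagged x :> nat))
  end.

Lemma spider_adj_sym : symmetric spider_adj.
Proof. by case=> [x|] [y|] //=; rewrite eq_sym orbC. Qed.

Lemma spider_adj_irrefl : irreflexive spider_adj.
Proof. by case=> [x|] //=; rewrite eqxx orbb gtn_eqF. Qed.

Definition spider : sgraph := SGraph spider_adj_sym spider_adj_irrefl.

Lemma card_spider : #|spider| = (\sum_i lambda i).+1.
Proof.
rewrite card_option card_tagged sumnE big_map big_enum /=.
by congr _.+1; apply: eq_bigr => i _; rewrite card_ord.
Qed.

End Spider.

(* Indexed so that F_0 = F_1 = 1. *)
Fixpoint fib (n : nat) : nat :=
  match n with
  | (q.+1 as p).+1 => fib p + fib q
  | _ => 1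
  end.

(* Main.v *)
From mathcomp Require Import all_boot all_order all_algebra.
From mathcomp Require Import zify.
Require Import Defs.

(** Root the spider at its center and describe a Markov equivalence class by the
set of edges that point towards the center and take part in an immorality at
their inner endpoint ([collider], packaged as [code]).

Two facts make this set a complete invariant ([markov_equiv_code]).  Every
vertex has at most one neighbor closer to the center, so every immorality
contains an edge pointing towards the center; and the spider is bipartite, so
any two arcs into the same vertex form an immorality.

The codes that occur are exactly the sets of edges such that no two consecutive
edges of a leg are chosen (an edge is chosen only if the next edge towards the
center points outwards) and the number of chosen edges at the center is not 1 (a
collision there involves at least two legs).  Such a set is realized by pointing
inwards exactly the chosen edges ([code_codes], [code_dag_of]), so M counts these
sets.

For a leg with m edges, the admissible bit strings without two consecutive trues
number F_(m-1) when the edge at the center is chosen and F_m when it is not,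
hence F_(m+1) in total.  Choosing the k legs independently gives F_(m+1)^k, from
which the k F_(m-1) F_m^(k-1) choices with exactly one chosen edge at the center
are removed ([card_codes]). *)

Set Implicit Arguments.
Unset Strict Implicit.
Unset Printing Implicit Defensive.

Import GRing.Theory.

(** * Partitions given by a complete invariant *)

Lemma card_equivalence_partition_key (T rT : finType) (f : T -> rT) (R : rel T)
    (D : {set T}) :
  {in D &, forall x y, R x y = (f x == f y)} ->
  #|equivalence_partition R D| = #|f @: D|.
Proof.
move=> Rf.
have -> : equivalence_partition R D = (fun c => [set y in D | c == f y]) @: (f @: D).
  rewrite -imset_comp; apply: eq_in_imset => x Dx.
  by apply/setP => y; rewrite !inE; case: (boolP (y \in D)) => //= Dy; rewrite Rf.
apply: card_in_imset => _ _ /imsetP[x Dx ->] /imsetP[y Dy ->] /setP/(_ x).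
by rewrite !inE Dx eqxx /= => /esym/eqP.
Qed.

(** * Counting codes *)

Section SparseCount.

Definition sparse : rel bool := fun a b => ~~ (a && b).

Lemma sum_tuple_cons (T : finType) n (F : seq T -> nat) :
  \sum_(t : n.+1.-tuple T) F t = \sum_(x : T) \sum_(t : n.-tuple T) F (x :: t).
Proof.
rewrite pair_big /= (reindex (fun p : T * n.-tuple T => [tuple of p.1 :: p.2])) //=.
exists (fun t : n.+1.-tuple T => (thead t, [tuple of behead t])) => [[x t]|t] _ /=.
  by congr (_, _); apply: val_inj.
by rewrite [RHS]tuple_eta; apply: val_inj.
Qed.

(** Prepending [b] lets the induction see the constraint on the first entry: after
a true the next entry is forced to be false, after a false it is free, which is
the Fibonacci recurrence. *)
Lemma sum_path_sparse n b :
  \sum_(t : n.-tuple bool) path sparse b t = fib (if b then n else n.+1).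
Proof.
elim: n b => [|n IHn] b.
  rewrite (eq_bigr (fun=> 1)) => [|t _]; last by rewrite tuple0.
  by rewrite sum1_card card_tuple; case: b.
rewrite (sum_tuple_cons n (fun s => path sparse b s : nat)) big_bool /=.
case: b => /=; last by rewrite !IHn addnC.
by rewrite big1 // add0n IHn.
Qed.

Lemma card_sparse_head n b :
  #|[pred t : n.+1.-tuple bool | sorted sparse t & head false t == b]|
  = fib (if b then n else n.+1).
Proof.
rewrite -sum1_card big_mkcond /= -sum_path_sparse.
rewrite (sum_tuple_cons n
  (fun s => if (s \in [pred t | sorted sparse t & head false t == b]) then 1 else 0)).
rewrite (bigD1 b) //= addnC big1 ?add0n => [|x /negPf xb]; last first.
  by apply: big1 => t _; rewrite inE /= xb andbF.
by apply: eq_bigr => t _; rewrite inE /= eqxx andbT; case: path.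
Qed.

Lemma card_sparse n :
  #|[pred t : n.+1.-tuple bool | sorted sparse t]| = fib n.+2.
Proof.
rewrite -(cardID [pred t : n.+1.-tuple bool | head false t]).
rewrite (_ : fib n.+2 = fib n + fib n.+1); last by rewrite addnC.
rewrite -{1}(card_sparse_head n true) -(card_sparse_head n false).
by congr (_ + _); apply: eq_card => t; rewrite !inE; case: (head _ t); rewrite ?andbT ?andbF.
Qed.

Definition heads k n (c : {ffun 'I_k -> n.+1.-tuple bool}) : {set 'I_k} :=
  [set i | head false (c i)].

(** The bit at position [a] of [c i] stands for the edge of leg [i] between the
vertices at distances [a] and [a.+1] from the center. *)
Definition codes k n : {set {ffun 'I_k -> n.+1.-tuple bool}} :=
  [set c : {ffun 'I_k -> n.+1.-tuple bool} |
    [forall i, sorted sparse (c i)] && (#|heads c| != 1)].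

(** The sum form avoids truncated subtraction. *)
Lemma card_codes k n :
  #|codes k n| + k * fib n * fib n.+1 ^ k.-1 = fib n.+2 ^ k.
Proof.
pose A := [set c : {ffun 'I_k -> n.+1.-tuple bool} | [forall i, sorted sparse (c i)]].
have cardA : #|A| = fib n.+2 ^ k.
  rewrite -(card_sparse n) -[in RHS](card_ord k) -card_ffun_on; apply: eq_card => c.
  by rewrite !inE; apply/forallP/ffun_onP.
(* The excluded configurations, sorted by the leg of the only chosen head. *)
pose one i := [set c in A | heads c == [set i]].
have card_one i : #|one i| = fib n * fib n.+1 ^ k.-1.
  rewrite (eq_card (B := family (fun j => [pred t : n.+1.-tuple bool |
      sorted sparse t & head false t == (j == i)]))); last first.
    move=> c; rewrite !inE; apply/andP/familyP => [[/forallP sc /eqP/setP hc] j|fc].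
      by rewrite inE sc -in_set1 -hc inE eqxx.
    split; first by apply/forallP => j; have /andP[] := fc j.
    by apply/eqP/setP => j; have /andP[_ /eqP] := fc j; rewrite !inE.
  rewrite card_family foldrE big_map big_enum /= (bigD1 i) //= card_sparse_head eqxx.
  congr (_ * _); rewrite (eq_bigr (fun=> fib n.+1)) => [|j /negPf ji].
    by rewrite prod_nat_const cardC1 card_ord.
  by rewrite card_sparse_head ji.
rewrite -cardA -(cardsID [set c | #|heads c| != 1]); congr (_ + _).
  by apply: eq_card => c; rewrite !inE.
transitivity (\sum_i #|one i|).
  by rewrite (eq_bigr _ (fun i _ => card_one i)) sum_nat_const card_ord mulnA.
under eq_bigr => i _ do rewrite -sum1_card big_mkcond /=.
rewrite exchange_big /= -sum1_card [RHS]big_mkcond /=; apply: eq_bigr => c _.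
rewrite !inE negbK; case: (boolP [forall i, _]) => Ac; last first.
  by rewrite andbF; apply: big1 => i _; rewrite !inE (negPf Ac).
rewrite andbT; case: ifPn => [/cards1P[i hi]|h1].
  rewrite (bigD1 i) //= !inE Ac hi eqxx big1 // => j ji.
  by rewrite !inE hi (inj_eq set1_inj) eq_sym (negPf ji) andbF.
apply: big1 => i _; rewrite !inE; case: eqP => [hi|]; last by rewrite andbF.
by rewrite hi cards1 in h1.
Qed.

End SparseCount.

(** * Adjacency in the spider *)

Section Spider.
Variables k n : nat.

Local Notation G := (spider (fun _ : 'I_k => n.+1)).
Implicit Types (D : {set G * G}) (i j : 'I_k).

(** The vertex at distance [a] from the center on leg [i].  All legs share the
center at distance 0, so that the edges of a leg are uniformly the pairs
[node i a], [node i a.+1]; the value is meaningful for [a <= n.+1]. *)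
Definition node i (a : nat) : G :=
  if a is b.+1 then Some (existT (fun=> 'I_n.+1) i (inord b))
  else None.

Arguments node : simpl never.

Lemma node_inj i j a b : a <= n -> b <= n ->
  node i a.+1 = node j b.+1 -> i = j /\ a = b.
Proof.
move=> an bn; rewrite /node => /Some_inj/eqP; rewrite -tag_eqE /tag_eq /= => /andP[/eqP ij].
by case: _ / ij; rewrite tagged_asE => /eqP /(congr1 (@nat_of_ord _)); rewrite !inordK.
Qed.

Lemma adj_node i a : a <= n -> @adj G (node i a.+1) (node i a).
Proof. by rewrite /node; case: a => [|a] an /=; rewrite ?eqxx ?inordK ?eqxx ?orbT //; lia. Qed.

Lemma adj_nodeP (x y : G) : adj x y ->
  exists i a, a <= n /\
    ((x, y) = (node i a.+1, node i a) \/ (x, y) = (node i a, node i a.+1)).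
Proof.
have vE i (a : 'I_n.+1) : Some (existT (fun=> 'I_n.+1) i a) = node i a.+1.
  by rewrite /node inord_val.
have le (a : 'I_n.+1) : a <= n by rewrite -ltnS.
case: x y => [[i a]|] [[j b]|] //=; rewrite !vE.
- move=> /andP[/eqP <- /orP[]/eqP ab].
    by exists i, b; rewrite -ab; split; [rewrite ab | right].
  by exists i, a; rewrite -ab; split; [rewrite ab | left].
- by move=> /eqP a0; exists i, 0; rewrite a0; split; last left.
- by move=> /eqP b0; exists j, 0; rewrite b0; split; last right.
Qed.

(** The second alternative gives a single vertex: this is the uniqueness of the
neighbor on the side of the center. *)
Lemma neighborP (x : G) i a : a <= n.+1 -> adj x (node i a) ->
  (exists j b, [/\ b <= n, x = node j b.+1 & node i a = node j b]) \/
  (exists2 b, a = b.+1 & x = node i b).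
Proof.
move=> an /adj_nodeP[j [b [bn [[-> ->]|[->]]]]]; first by left; exists j, b.
case: a an => // a an /(node_inj an bn)[-> ->]; by right; exists b.
Qed.

Definition depth (x : G) : nat := if x is Some v then (tagged v).+1 else 0.

Lemma depth_node i a : a <= n.+1 -> depth (node i a) = a.
Proof. by case: a => //= a an; rewrite /= inordK. Qed.

(** Bipartiteness, the reason why the spider has no triangle. *)
Lemma odd_depth_adj (x y : G) : adj x y -> odd (depth x) = ~~ odd (depth y).
Proof.
by move=> /adj_nodeP[i [a [an [[-> ->]|[-> ->]]]]]; rewrite !depth_node ?negbK // ltnW.
Qed.

(** * Immoralities of an orientation of the spider *)

Lemma orientationP D : reflect (skeleton D =2 @adj G /\
  forall x y, arc D x y -> arc D y x = false) (orientation D).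
Proof.
apply: (iffP forallP) => [h|[sk asym] x].
  split=> x y; have /forallP/(_ y)/andP[/eqP sk] := h x => //.
  by move=> + xy; rewrite xy => /negPf.
apply/forallP => y; rewrite sk eqxx; apply/negP => /andP[xy].
by rewrite (asym _ _ xy).
Qed.

Section Orientation.
Variable D : {set G * G}.
Hypothesis oD : orientation D.

Lemma arc_adj (x y : G) : arc D x y -> adj x y.
Proof. by case/orientationP: oD => sk _ xy; rewrite -sk /skeleton xy. Qed.

(** Two neighbors of [y] have the same depth parity, so they are never adjacent. *)
Lemma immoralityE (x y z : G) :
  immorality D x y z = [&& x != z, arc D x y & arc D z y].
Proof.
rewrite /immorality; case/orientationP: oD => -> _.
case: (boolP (arc D x y)) => [/arc_adj/odd_depth_adj xy|]; last by rewrite /= !andbF.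
case: (boolP (arc D z y)) => [/arc_adj/odd_depth_adj zy|]; last by rewrite /= !andbF.
suff -> : adj x z = false by [].
by apply/negP => /odd_depth_adj; rewrite xy zy; case: odd.
Qed.

Lemma immorality_sym (x y z : G) : immorality D x y z = immorality D z y x.
Proof. by rewrite !immoralityE eq_sym andbCA andbC -andbA andbCA. Qed.

End Orientation.

Definition collider D i a : bool :=
  [exists w, immorality D (node i a.+1) (node i a) w].

Lemma collider_arc D i a : collider D i a -> arc D (node i a.+1) (node i a).
Proof. by case/existsP => w /and3P[]. Qed.

Lemma immorality_collider D i a w :
  immorality D (node i a.+1) (node i a) w -> collider D i a.
Proof. by move=> h; apply/existsP; exists w. Qed.

(** An inner vertex of a leg has two neighbors, so a collision at it can only come
from both sides. *)
Lemma collider_inner D i a : orientation D -> a < n -> 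
  collider D i a.+1 = arc D (node i a.+2) (node i a.+1) && arc D (node i a) (node i a.+1).
Proof.
move=> oD an; apply/existsP/andP => [[w]|[h1 h2]].
  rewrite immoralityE // => /and3P[xw -> wy]; split=> //.
  have /neighborP[|[j [b [bn wE]]]|[b [<-] <- //]] := arc_adj oD wy; first exact: ltnW.
  case: b bn wE => // b bn wE /node_inj[] //; [exact: ltnW | exact: ltnW | ].
  by move=> ij ab; rewrite wE ij ab eqxx in xw.
exists (node i a); rewrite immoralityE // h1 h2 !andbT.
by apply/eqP => /(congr1 depth); rewrite !depth_node; lia.
Qed.

Lemma collider_center D i : orientation D ->
  collider D i 0 = arc D (node i 1) None && [exists j, (j != i) && arc D (node j 1) None].
Proof.
move=> oD; apply/existsP/andP => [[w]|[h1 /existsP[j /andP[ji h2]]]].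
  rewrite immoralityE // => /and3P[xw -> wy]; split=> //.
  have /(@neighborP w i 0)[//|[j [b [bn wE]]]|[b]//] := arc_adj oD wy.
  case: b bn wE => // bn wE _; apply/existsP; exists j; rewrite -wE wy andbT.
  by apply: contra_neq xw => <-; rewrite wE.
exists (node j 1); rewrite immoralityE // h1 h2 !andbT.
by apply: contra_neq ji => /node_inj[].
Qed.

(** At least one of the two arcs of an immorality comes from farther out, and that
arc is a collider.  If the other one does too, it is a collider as well, and
colliders fix the direction of their arcs.  Otherwise the other arc comes from
the side of the center, and the first collider alone forces it, because no other
vertex can collide with it. *)
Lemma collider_immorality D1 D2 : orientation D1 -> orientation D2 ->
  (forall i a, a <= n -> collider D1 i a = collider D2 i a) ->
  forall x y z, immorality D1 x y z -> immorality D2 x y z.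
Proof.
move=> o1 o2 eqc.
have child i a z : a <= n -> immorality D1 (node i a.+1) (node i a) z ->
    immorality D2 (node i a.+1) (node i a) z.
  move=> an h; move: (immorality_collider h); rewrite eqc // => c2.
  have := h; rewrite !immoralityE // => /and3P[-> _ zy].
  rewrite (collider_arc c2) /=.
  have /neighborP[|[j [b [bn zE yE]]]|[b ab zE]] := arc_adj o1 zy; first exact: ltnW.
    rewrite zE yE; apply: collider_arc; rewrite -eqc //.
    apply: (@immorality_collider _ _ _ (node i a.+1)).
    by rewrite -yE -zE immorality_sym.
  (* [z] lies on the side of the center, so [node i a] is inner. *)
  by move: c2 an; rewrite zE ab => + an; rewrite collider_inner // => /andP[].
move=> x y z h; have /and4P[xz xy zy _] := h.
have /adj_nodeP[i [a [an [[xE yE]|[xE yE]]]]] := arc_adj o1 xy.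
  by move: h; rewrite xE yE; apply: child.
have := arc_adj o1 zy; rewrite yE => /neighborP[|[j [b [bn zE ab]]]|[b [ab] zE]] //.
  by move: h; rewrite (immorality_sym o1) (immorality_sym o2) yE zE ab; apply: child.
by rewrite xE zE ab eqxx in xz.
Qed.

(** * Codes classify Markov equivalence *)

Definition code D : {ffun 'I_k -> n.+1.-tuple bool} :=
  [ffun i => [tuple collider D i a | a < n.+1]].

Lemma nth_code D i a : a <= n -> nth false (code D i) a = collider D i a.
Proof. by move=> an; rewrite ffunE (nth_mktuple _ _ (Ordinal (an : a < n.+1))). Qed.

Lemma head_code D i : head false (code D i) = collider D i 0.
Proof. by rewrite -nth0 nth_code. Qed.

Lemma markov_equiv_code D1 D2 : orientation D1 -> orientation D2 ->
  markov_equiv D1 D2 = (code D1 == code D2).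
Proof.
move=> o1 o2; apply/markov_equivP/eqP => [[_ im]|eqc].
  apply/ffunP => i; rewrite !ffunE; apply: eq_from_tnth => a; rewrite !tnth_mktuple.
  by apply: eq_existsb => w; rewrite im.
have eqc' i a : a <= n -> collider D1 i a = collider D2 i a.
  by move=> an; rewrite -!nth_code // eqc.
split=> [x y|x y z].
  by case/orientationP: o1 => -> _; case/orientationP: o2 => ->.
by apply/idP/idP; apply: collider_immorality => // i a an; rewrite eqc'.
Qed.

Lemma code_codes D : orientation D -> code D \in codes k n.
Proof.
move=> oD; have [_ asym] := orientationP D oD; rewrite inE; apply/andP; split.
  apply/forallP => i; apply/(sortedP false) => a; rewrite size_tuple => an.
  rewrite /sparse !nth_code //; last exact: ltnW.
  apply/negP => /andP[/collider_arc h].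
  by rewrite collider_inner // (asym _ _ h) andbF.
apply/negP => /cards1P[i /setP hi].
have := hi i; rewrite !inE eqxx head_code collider_center // => /andP[h1].
case/existsP => j /andP[ji h2]; have := hi j.
rewrite !inE (negPf ji) head_code collider_center // h2 /= => /existsP[].
by exists i; rewrite eq_sym ji.
Qed.

(** * Realizing a code by a DAG *)

Section DagOf.
Variable c : {ffun 'I_k -> n.+1.-tuple bool}.

Definition dag_of : {set G * G} :=
  [set p | [exists i, exists a : 'I_n.+1,
    p == if nth false (c i) a then (node i a.+1, node i a) else (node i a, node i a.+1)]].

Lemma arc_dag_of i a : a <= n ->
  if nth false (c i) a then arc dag_of (node i a.+1) (node i a)
  else arc dag_of (node i a) (node i a.+1).
Proof.
move=> an; rewrite /arc; case: ifP => ca; rewrite inE;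
by apply/existsP; exists i; apply/existsP; exists (Ordinal (an : a < n.+1)); rewrite /= ca.
Qed.

(** Every arc raises this potential by one; this rules out directed cycles as well
as pairs of opposite arcs. *)
Definition height (x : G) : int := (if x is Some v then
  \sum_(b < (tagged v).+1) (if nth false (c (tag v)) b then -1 else 1) else 0)%R.

Lemma height_node i a : a <= n.+1 ->
  height (node i a) = (\sum_(b < a) (if nth false (c i) b then -1 else 1))%R.
Proof. by case: a => [|a] an; rewrite /node /= ?big_ord0 ?inordK. Qed.

Lemma height_arc x y : arc dag_of x y -> height y = (height x + 1)%R.
Proof.
rewrite /arc inE => /existsP[i /existsP[a]].
case: ifP => ca /eqP[-> ->]; rewrite !height_node ?big_ord_recr /= ?ca ?addrNK //;
  exact: ltnW.
Qed.

Lemma acyclic_dag_of : acyclic dag_of.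
Proof.
have mono x y : connect (arc dag_of) x y -> (height x <= height y)%R.
  case/connectP => p + ->; elim: p x => //= z p IHp x /andP[/height_arc xz /IHp].
  by rewrite xz; lia.
apply/forallP => x; apply/forallP => y; apply/implyP => /height_arc xy.
by apply/negP => /mono; rewrite xy; lia.
Qed.

Lemma orientation_dag_of : orientation dag_of.
Proof.
apply/orientationP; split=> x y.
  apply/orP/idP => [|/adj_nodeP[i [a [an]]]].
    rewrite /arc !inE => -[]/existsP[i /existsP[a]]; have an : a <= n by rewrite -ltnS.
      by case: ifP => _ /eqP[-> ->]; rewrite ?[adj (node _ a) _]adj_sym adj_node.
    by case: ifP => _ /eqP[-> ->]; rewrite ?[adj (node _ a) _]adj_sym adj_node.
  by have := arc_dag_of i an; case: ifP => _ ? [[-> ->]|[-> ->]]; [left|right|right|left].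
move=> /height_arc xy; apply/negP => /height_arc; rewrite xy; lia.
Qed.

Lemma arc_dag_ofE i a : a <= n -> 
  (arc dag_of (node i a.+1) (node i a) = nth false (c i) a) *
  (arc dag_of (node i a) (node i a.+1) = ~~ nth false (c i) a).
Proof.
have [_ asym] := orientationP _ orientation_dag_of.
by move=> /(arc_dag_of i); case: ifP => _ h; rewrite h (asym _ _ h).
Qed.

(** An edge pointing inwards always collides in [dag_of c]: with the next edge of
its leg, which is not chosen and so points outwards, or, at the center, with
another chosen edge. *)
Lemma code_dag_of : c \in codes k n -> code dag_of = c.
Proof.
have oD := orientation_dag_of; rewrite inE => /andP[/forallP sc hc].
apply/ffunP => i; apply/val_inj/(@eq_from_nth _ false); rewrite ?size_tuple // => a an.
rewrite nth_code //; case: a an => [_|a an]; last first.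
  have an' : a <= n by exact: ltnW.
  rewrite collider_inner // !arc_dag_ofE //.
  have /(sortedP false)/(_ a) := sc i; rewrite size_tuple => /(_ an).
  by rewrite /sparse; do 2!case: nth.
rewrite collider_center // (arc_dag_ofE i (leq0n n)).
case: (boolP (nth false (c i) 0)) => // ci.
apply: contraNT hc => /existsPn nj; apply/cards1P; exists i.
apply/setP => j; rewrite !inE -nth0; have := nj j.
have [-> _|ji] := eqVneq j i; first by rewrite ci.
by rewrite (arc_dag_ofE j (leq0n n)) => /negPf.
Qed.

End DagOf.

Lemma M_spider : M G = #|codes k n|.
Proof.
rewrite /M /MECs (@card_equivalence_partition_key _ _ code); last first.
  by move=> D1 D2; rewrite !inE => /andP[o1 _] /andP[o2 _]; apply: markov_equiv_code.
apply: eq_card => c; apply/imsetP/idP => [[D]|Cc].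
  by rewrite inE => /andP[oD _] ->; apply: code_codes.
by exists (dag_of c); rewrite ?code_dag_of // inE orientation_dag_of acyclic_dag_of.
Qed.

End Spider.

Theorem corollary4p2 (k m : nat) (hk : 1 < k) (hm : 1 <= m) :
  ((M (spider (fun _ : 'I_k => m)))%:Z
   = (fib m.+1)%:Z ^+ k
     - k%:Z * (fib m.-1)%:Z * (fib m)%:Z ^+ k.-1)%R.
Proof.
case: m hm => // n _; rewrite M_spider -!rmorphXn !natrXE -!PoszM -card_codes.
by rewrite rmorphD /= addrK.
Qed.
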